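(* Let $n\ge 2$ and suppose $\chi=(P_1,\ldots,P_{n+1})$ is a degree one vector field on $\mathbb{S}^n$, written as $P_i=\sum_{j=1}^{n+1}A_{ij}x_j$ for $i=1,\ldots,n+1$, where $A=(A_{ij})$ is a constant real skew-symmetric $(n+1)\times(n+1)$ matrix. Let $a_1,\ldots,a_{n+1}\in\mathbb{R}$ with $\sum_i a_i^2=1$. Then $\{\sum_{i=1}^{n+1}a_ix_i=0\}\cap\mathbb{S}^n$ is an invariant great $(n-1)$-sphere of $\chi$ if and only if $(a_1,\ldots,a_{n+1})^t$ is an eigenvector of $A$ corresponding to the eigenvalue $0$.
   Context: $\mathbb{S}^n=\{x\in\mathbb{R}^{n+1} : \sum_i x_i^2=1\}$. A polynomial vector field $\chi=(P_1,\ldots,P_{n+1})$ in $\mathbb{R}^{n+1}$ is identified with the operator $\sum_i P_i\,\partial/\partial x_i$; its degree is $\max_i\deg P_i$. It is a vector field on $\mathbb{S}^n$ if $\chi(\sum_i x_i^2-1)=K(\sum_i x_i^2-1)$ for some real polynomial $K$. A subset of $\mathbb{R}^{n+1}$ is invariant for $\chi$ if it is a union of trajectories of $\chi$. A great $(n-1)$-sphere in $\mathbb{S}^n$ is an intersection $\{\sum_{i=1}^{n+1}a_ix_i=0\}\cap\mathbb{S}^n$ with $a_i\in\mathbb{R}$, $\sum_i a_i^2=1$. *)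

(* Defs.v *)
From HB Require Import structures.
From mathcomp Require Import all_boot all_order all_algebra.
From mathcomp Require Import all_classical all_reals all_analysis.
(* The notations of mpoly and of MathComp-Analysis clash, so those of mpoly
   are left out. *)
From mathcomp.multinomials Require mpoly.
Import -(notations) mpoly.
Set Implicit Arguments.
Unset Strict Implicit.
Unset Printing Implicit Defensive.
Import Order.TTheory GRing.Theory Num.Theory.
Import numFieldNormedType.Exports.
Local Open Scope classical_set_scope.
Local Open Scope ring_scope.

Definition mvar (R : realType) (m : nat) (i : 'I_m) : mpoly m R :=
  mpolyX R (mnm1 i).

Definition vfield (R : realType) (m : nat) := 'I_m -> mpoly m R.

(* [msize p] is the total degree of [p] plus one (and 0 for [p = 0]); the zero
   polynomial is given degree 0 here. *)
Definition vfield_degree (R : realType) (m : nat) (P : vfield R m) : nat :=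
  \max_(i < m) (msize (P i)).-1.

Definition vfield_apply (R : realType) (m : nat) (P : vfield R m)
    (f : mpoly m R) : mpoly m R :=
  \sum_(i < m) P i * mderiv i f.

Definition sphere_poly (R : realType) (m : nat) : mpoly m R :=
  \sum_(i < m) mvar R i ^+ 2 - 1.

Definition vfield_on_sphere (R : realType) (m : nat) (P : vfield R m) : Prop :=
  exists K : mpoly m R,
    vfield_apply P (sphere_poly R m) = K * sphere_poly R m.

Definition vfield_eval (R : realType) (m : nat) (P : vfield R m)
    (x : 'cV[R]_m) : 'cV[R]_m :=
  \col_(i < m) meval (fun j => x j 0) (P i).

(* [g] is a total function, but only its values on [I] matter. *)
Definition integral_curve (R : realType) (n : nat) (P : vfield R n.+1)
    (I : set R) (g : R -> 'cV[R]_n.+1) : Prop :=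
  [/\ open I, is_interval I, I !=set0 &
      forall t : R, I t -> is_derive t (1 : R) g (vfield_eval P (g t))].

Definition maximal_integral_curve (R : realType) (n : nat)
    (P : vfield R n.+1) (I : set R) (g : R -> 'cV[R]_n.+1) : Prop :=
  integral_curve P I g /\
  forall (J : set R) (h : R -> 'cV[R]_n.+1),
    integral_curve P J h -> I `<=` J -> (forall t, I t -> h t = g t) -> J = I.

Definition trajectory (R : realType) (n : nat) (P : vfield R n.+1)
    (T : set 'cV[R]_n.+1) : Prop :=
  exists (I : set R) (g : R -> 'cV[R]_n.+1),
    maximal_integral_curve P I g /\ T = g @` I.

Definition invariant_set (R : realType) (n : nat) (P : vfield R n.+1)
    (S : set 'cV[R]_n.+1) : Prop :=
  exists F : set (set 'cV[R]_n.+1),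
    (forall T, F T -> trajectory P T) /\ S = \bigcup_(T in F) T.

Definition unit_sphere (R : realType) (n : nat) : set 'cV[R]_n.+1 :=
  [set x | \sum_(i < n.+1) x i 0 ^+ 2 = 1].
Arguments unit_sphere R n : clear implicits.

Definition hyperplane (R : realType) (n : nat) (a : 'cV[R]_n.+1) :
    set 'cV[R]_n.+1 :=
  [set x | \sum_(i < n.+1) a i 0 * x i 0 = 0].

Definition great_sphere (R : realType) (n : nat) (S : set 'cV[R]_n.+1) : Prop :=
  exists a : 'cV[R]_n.+1,
    \sum_(i < n.+1) a i 0 ^+ 2 = 1 /\ S = hyperplane a `&` unit_sphere R n.

Definition invariant_great_sphere (R : realType) (n : nat)
    (P : vfield R n.+1) (S : set 'cV[R]_n.+1) : Prop :=
  great_sphere S /\ invariant_set P S.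

(* MathComp's [eigenspace] acts on row vectors ([v *m A = l *: v]), whereas
   eigenvectors are columns here. *)
Definition col_eigenvector (R : realType) (m : nat) (A : 'M[R]_m) (l : R)
    (v : 'cV[R]_m) : Prop :=
  v != 0 /\ A *m v = l *: v.

(* Main.v *)
Require Import Defs.
From mathcomp Require Import all_boot all_order all_algebra.
From mathcomp Require Import all_classical all_reals all_analysis.
From mathcomp.multinomials Require mpoly.
Import -(notations) mpoly.
Import Order.TTheory GRing.Theory Num.Theory.
Import numFieldNormedType.Exports.
Local Open Scope classical_set_scope.
Local Open Scope ring_scope.

(** The field is [x |-> A *m x] on columns, and the skew-symmetry of [A] means
    [dot u (A *m v) = - dot (A *m u) v]; in particular [dot u (A *m u) = 0].

    If the great sphere orthogonal to [a] is invariant, then differentiating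
    [dot a (g t) = 0] along trajectories [g] shows that [A *m a] is orthogonal
    to every point of that sphere ([invariant_set_orthogonal]). As [A *m a] is
    orthogonal to [a], it would give such a point after normalization if it
    were nonzero, and a nonzero vector is not orthogonal to itself
    ([invariant_hyperplane_sphere_kernel]).

    Conversely, let [A *m a = 0]. Through each point [x] of the sphere passes
    the curve [exp (t A) x], constructed coordinatewise as a power series
    ([is_derive_expmx_orbit]). It is defined for all times, hence is maximal
    ([trajectory_total]), and it preserves both the norm and the product with
    [a] ([dot_flow_constant]), so it remains in the great sphere
    ([kernel_invariant_hyperplane_sphere]). *)

Set Implicit Arguments.
Unset Strict Implicit.

(** * The Euclidean product and skew-symmetric matrices *)

Definition dot {R : realType} {m : nat} (u v : 'cV[R]_m) : R :=
  \sum_(i < m) u i 0 * v i 0.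

Lemma dotC {R : realType} {m : nat} (u v : 'cV[R]_m) : dot u v = dot v u.
Proof. by apply: eq_bigr => i _; rewrite mulrC. Qed.

Lemma dotNl {R : realType} {m : nat} (u v : 'cV[R]_m) :
  dot (- u) v = - dot u v.
Proof. by rewrite /dot -sumrN; apply: eq_bigr => i _; rewrite !mxE mulNr. Qed.

Lemma dotZr {R : realType} {m : nat} (k : R) (u v : 'cV[R]_m) :
  dot u (k *: v) = k * dot u v.
Proof.
by rewrite /dot mulr_sumr; apply: eq_bigr => i _; rewrite mxE mulrCA.
Qed.

Lemma dot0l {R : realType} {m : nat} (v : 'cV[R]_m) : dot 0 v = 0.
Proof. by rewrite /dot big1// => i _; rewrite mxE mul0r. Qed.

Lemma dot_sqr {R : realType} {m : nat} (u : 'cV[R]_m) :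
  dot u u = \sum_(i < m) u i 0 ^+ 2.
Proof. by apply: eq_bigr => i _; rewrite expr2. Qed.

Lemma dot_self_ge0 {R : realType} {m : nat} (u : 'cV[R]_m) : 0 <= dot u u.
Proof. by rewrite dot_sqr sumr_ge0// => i _; exact: sqr_ge0. Qed.

Lemma dot_self_eq0 {R : realType} {m : nat} (u : 'cV[R]_m) :
  dot u u = 0 -> u = 0.
Proof.
rewrite dot_sqr => /eqP; rewrite psumr_eq0 => [/allP u0|i _]; last first.
  exact: sqr_ge0.
apply/matrixP => i j; rewrite ord1 mxE; apply/eqP.
by rewrite -sqrf_eq0; apply: u0; rewrite mem_index_enum.
Qed.

Lemma dot_mulmx_skew {R : realType} {m : nat} (A : 'M[R]_m) (u v : 'cV[R]_m) :
  A^T = - A -> dot u (A *m v) = - dot (A *m u) v.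
Proof.
have dotE (w z : 'cV[R]_m) : dot w z = (w^T *m z) 0 0.
  by rewrite mxE; apply: eq_bigr => i _; rewrite mxE.
by move=> skA; rewrite -dotNl -mulNmx -skA !dotE trmx_mul trmxK mulmxA.
Qed.

(** [dot u (A *m u)] equals its own opposite. *)
Lemma dot_mulmx_skew_self {R : realType} {m : nat} (A : 'M[R]_m)
    (u : 'cV[R]_m) :
  A^T = - A -> dot u (A *m u) = 0.
Proof.
move=> skA; have := dot_mulmx_skew u u skA; rewrite [in RHS]dotC => /eqP.
by rewrite -addr_eq0 -mulr2n mulrn_eq0 => /eqP.
Qed.

(** * Derivatives of curves *)

Lemma is_derive_mxP {R : realType} {m n : nat} (g : R -> 'M[R]_(m, n))
    (t : R) (d : 'M[R]_(m, n)) :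
  is_derive t (1 : R) g d <->
  forall i j, is_derive t (1 : R) (fun s => g s i j) (d i j).
Proof.
split=> [[dg gE] i j|dg].
  have dgij := (derivable_mxP g t 1).1 dg i j.
  by apply: DeriveDef => //; rewrite -gE derive_mx// mxE.
have dgt : derivable g t 1.
  by apply/derivable_mxP => i j; have [] := dg i j.
apply: DeriveDef => //; rewrite derive_mx//; apply/matrixP => i j.
by rewrite mxE; have [_ ->] := dg i j.
Qed.

(** The product rule; it turns orthogonality relations between a curve and its
    velocity into conservation laws, and conversely. *)
Lemma is_derive_dot {R : realType} {m : nat} (f g : R -> 'cV[R]_m)
    (t : R) (df dg : 'cV[R]_m) :
  is_derive t (1 : R) f df -> is_derive t (1 : R) g dg ->
  is_derive t (1 : R) (fun s => dot (f s) (g s)) (dot (f t) dg + dot (g t) df).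
Proof.
move=> /is_derive_mxP Df /is_derive_mxP Dg.
have -> : (fun s => dot (f s) (g s)) =
    \sum_(i < m) ((fun s => f s i 0) * (fun s => g s i 0)).
  by apply/funext => s; rewrite fct_sumE.
(* Instance resolution differentiates the sum of products, from [Df] and
   [Dg]. *)
apply: is_derive_eq.
by rewrite /= big_split.
Qed.

(** * The solution [exp (t A) x] of a linear differential equation *)

(** With [B] the sum of the [`|x i 0|] and [M] the sum of the [`|A i j|], one
    multiplication by [A] enlarges a common bound on the coordinates by a
    factor of at most [M].
    This geometric growth is what makes the exponential series converge for
    every [t]. *)
Lemma iter_mulmx_bounded {R : realType} {m : nat} (A : 'M[R]_m)
    (x : 'cV[R]_m) :
  exists B M : R, [/\ 0 <= B, 0 <= M &
    forall k i, `|iter k (mulmx A) x i 0| <= B * M ^+ k].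
Proof.
pose B := \sum_i `|x i 0|; pose M := \sum_i \sum_j `|A i j|.
have B0 : 0 <= B by apply: sumr_ge0.
have M0 : 0 <= M by apply: sumr_ge0 => i _; apply: sumr_ge0.
exists B, M; split => // k; elim: k => [|k IH] i /=.
  by rewrite expr0 mulr1 /B (bigD1 i)//= lerDl sumr_ge0.
rewrite mxE (le_trans (ler_norm_sum _ _ _))//.
apply: (@le_trans _ _ (\sum_j `|A i j| * (B * M ^+ k))).
  by apply: ler_sum => j _; rewrite normrM ler_wpM2l.
rewrite -mulr_suml exprS [leRHS]mulrCA ler_wpM2r ?mulr_ge0 ?exprn_ge0//.
by rewrite /M [leRHS](bigD1 i)//= lerDl sumr_ge0// => l _; apply: sumr_ge0.
Qed.

(** The coefficient of [t ^ k] in the [i]-th coordinate of [exp (t A) x]. The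
    powers of [A] are applied to the vector [x] so that everything reduces to
    scalar power series, one for each coordinate. *)
Definition expmx_coef {R : realType} {m : nat} (A : 'M[R]_m) (x : 'cV[R]_m)
    (i : 'I_m) (k : nat) : R :=
  iter k (mulmx A) x i 0 / k`!%:R.

Definition expmx_orbit {R : realType} {m : nat} (A : 'M[R]_m) (x : 'cV[R]_m)
    (t : R) : 'cV[R]_m :=
  \col_i limn (pseries (expmx_coef A x i) t).

(** By [iter_mulmx_bounded] the terms are dominated by those of the series of
    [B * exp (M * `|t|)]. *)
Lemma is_cvg_expmx_coef {R : realType} {m : nat} (A : 'M[R]_m) (x : 'cV[R]_m)
    (i : 'I_m) (t : R) :
  cvgn (pseries (expmx_coef A x i) t).
Proof.
have [B [M [B0 M0 AB]]] := iter_mulmx_bounded A x.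
apply: normed_cvg.
apply: (@series_le_cvg _ _ (B *: exp_coeff (M * `|t|))) => [k|k|k|].
- exact: normr_ge0.
- by rewrite mulr_ge0// exp_coeff_ge0// mulr_ge0.
- have -> : (B *: exp_coeff (M * `|t|)) k =
      B * ((M * `|t|) ^+ k / k`!%:R) by [].
  rewrite /= !normrM normfV normr_nat normrX exprMn.
  rewrite -[leRHS](_ : B * M ^+ k / k`!%:R * `|t| ^+ k = _); last first.
    by rewrite -!mulrA; congr (_ * (_ * _)); rewrite mulrC.
  by rewrite ler_wpM2r ?exprn_ge0// ler_wpM2r ?invr_ge0.
- by apply: is_cvg_seriesZ; exact: is_cvg_series_exp_coeff.
Qed.

(** Termwise differentiation shifts [A ^ k x / k`!] to [A ^ (k + 1) x / k`!],
    that is, it replaces [x] by [A *m x]. The derived series is thus a series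
    of the same kind, and [is_cvg_expmx_coef] covers it as well. *)
Lemma pseries_diffs_expmx_coef {R : realType} {m : nat} (A : 'M[R]_m)
    (x : 'cV[R]_m) (i : 'I_m) :
  pseries_diffs (expmx_coef A x i) = expmx_coef A (A *m x) i.
Proof.
apply/funext => k; rewrite /pseries_diffs /expmx_coef iterSr factS natrM invfM.
by rewrite mulrCA mulVKf.
Qed.

(** [A] commutes with its powers, and multiplication by [A], a finite linear
    combination of coordinates, commutes with the limit. *)
Lemma expmx_orbit_mulmx {R : realType} {m : nat} (A : 'M[R]_m)
    (x : 'cV[R]_m) (t : R) :
  expmx_orbit A (A *m x) t = A *m expmx_orbit A x t.
Proof.
apply/matrixP => i j; rewrite ord1 !mxE; apply/cvg_lim => //.
have -> : pseries (expmx_coef A (A *m x) i) t =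
    (fun k => \sum_j A i j * pseries (expmx_coef A x j) t k).
  apply/funext => k; rewrite /pseries/series /=.
  under [RHS]eq_bigr do rewrite mulr_sumr.
  rewrite exchange_big; apply: eq_bigr => l _.
  rewrite /expmx_coef -iterSr /= mxE mulr_suml mulr_suml.
  by apply: eq_bigr => j' _; rewrite !mulrA.
apply: cvg_big => [|j' _]; first exact: add_continuous.
by rewrite mxE; apply: cvgMl_tmp; exact: is_cvg_expmx_coef.
Qed.

Lemma is_derive_expmx_orbit {R : realType} {m : nat} (A : 'M[R]_m)
    (x : 'cV[R]_m) (t : R) :
  is_derive t (1 : R) (expmx_orbit A x) (A *m expmx_orbit A x t).
Proof.
apply/is_derive_mxP => i j; rewrite ord1 -expmx_orbit_mulmx.
rewrite [X in is_derive _ _ _ X]mxE.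
rewrite (_ : (fun s => _) =
    fun s => limn (pseries (expmx_coef A x i) s)); last first.
  by apply/funext => s; rewrite mxE.
rewrite -pseries_diffs_expmx_coef.
(* The theorem on termwise differentiation needs convergence at some point
   farther from 0 than [t]; since the radius is infinite, `|t| + 1 will do. *)
apply: (@pseries_snd_diffs _ _ (`|t| + 1));
  rewrite ?pseries_diffs_expmx_coef; try exact: is_cvg_expmx_coef.
by rewrite [ltRHS]ger0_norm ?addr_ge0// ltrDl.
Qed.

Lemma expmx_orbit0 {R : realType} {m : nat} (A : 'M[R]_m) (x : 'cV[R]_m) :
  expmx_orbit A x 0 = x.
Proof.
apply/matrixP => i j; rewrite ord1 !mxE; apply/cvg_lim => //.
(* The empty partial sum is 0, and all later ones are equal to [x i 0]. *)
rewrite -cvg_shiftS /=.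
rewrite (_ : (fun k => _) = cst (x i 0)); first exact: cvg_cst.
apply/funext => k; rewrite /pseries/series /= big_nat_recl// big1 ?addr0.
  by rewrite expr0 mulr1 /expmx_coef /= fact0 divr1.
by move=> l _; rewrite expr0n mulr0.
Qed.

(** * Trajectories and invariant sets *)

Lemma vfield_eval_linear {R : realType} {m : nat} (P : vfield R m)
    (A : 'M[R]_m) (x : 'cV[R]_m) :
  (forall i, P i = \sum_(j < m) A i j *: mvar R j) ->
  vfield_eval P x = A *m x.
Proof.
move=> PE; apply/matrixP => i j; rewrite ord1 !mxE PE raddf_sum.
by apply: eq_bigr => l _; rewrite /= mevalZ mevalXU.
Qed.

(** A solution defined on the whole line admits no larger interval, hence
    it is maximal. *)
Lemma trajectory_total {R : realType} {n : nat} (P : vfield R n.+1)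
    (g : R -> 'cV[R]_n.+1) :
  (forall t, is_derive t (1 : R) g (vfield_eval P (g t))) ->
  trajectory P (range g).
Proof.
move=> dg; exists setT, g; split=> //; split.
  by split=> //; [exact: openT|exists 0].
by move=> J h _ TJ _; apply/seteqP; split.
Qed.

Lemma invariant_set_integral_curve {R : realType} {n : nat}
    (P : vfield R n.+1) (S : set 'cV[R]_n.+1) (x : 'cV[R]_n.+1) :
  invariant_set P S -> S x ->
  exists I g t, [/\ integral_curve P I g, I t, g t = x &
    forall s, I s -> S (g s)].
Proof.
move=> [F [Ftraj ->]] [T FT Tx].
have [I [g [[Pg _] TE]]] := Ftraj T FT.
move: Tx; rewrite TE => -[t It gtx].
by exists I, g, t; split => // s Is; exists T => //; rewrite TE; exists s.
Qed.

(** The trajectory through [x] stays in the hyperplane, so [dot a] vanishes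
    along it, and so does its derivative. *)
Lemma invariant_set_orthogonal {R : realType} {n : nat}
    (P : vfield R n.+1) (S : set 'cV[R]_n.+1) (a x : 'cV[R]_n.+1) :
  invariant_set P S -> S `<=` hyperplane a -> S x ->
  dot a (vfield_eval P x) = 0.
Proof.
move=> invS Sa /(invariant_set_integral_curve invS).
move=> [I [g [t [[openI _ _ dg] It <- SI]]]].
have Da := is_derive_dot (is_derive_cst a t (1 : R)) (dg t It).
have : is_derive t (1 : R) (fun s => dot (cst a s) (g s)) 0.
  apply: (@near_eq_is_derive _ _ _ (cst 0)).
  near=> s; apply/esym/Sa/SI; near: s.
  exact: open_nbhs_nbhs.
move=> [_ D0]; have [_] := Da; rewrite D0 /=.
by rewrite (dotC (g t)) dot0l addr0.
Unshelve. all: by end_near. Qed.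

(** Since [dot a (A *m x) = - dot (A *m a) x], tangency says that [A *m a] is
    orthogonal to every point of the great sphere. But [A *m a] is itself
    orthogonal to [a], so unless it is zero its normalization is such a
    point. *)
Lemma invariant_hyperplane_sphere_kernel {R : realType} {n : nat}
    (P : vfield R n.+1) (A : 'M[R]_n.+1) (a : 'cV[R]_n.+1) :
  A^T = - A -> (forall x, vfield_eval P x = A *m x) ->
  invariant_set P (hyperplane a `&` unit_sphere R n) -> A *m a = 0.
Proof.
move=> skA PA inv; set w := A *m a; apply/eqP/negP => /negP w0.
have ww_gt0 : 0 < dot w w.
  rewrite lt0r dot_self_ge0 andbT; apply: contra w0 => /eqP ww0.
  exact/eqP/dot_self_eq0.
pose k := (Num.sqrt (dot w w))^-1.
have Sx : (hyperplane a `&` unit_sphere R n) (k *: w).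
  split.
    rewrite /hyperplane /= -/(dot _ _) dotZr.
    by rewrite dot_mulmx_skew_self// mulr0.
  rewrite /unit_sphere /= -dot_sqr dotZr dotC dotZr mulrA -expr2 exprVn.
  by rewrite sqr_sqrtr ?dot_self_ge0// mulVf// gt_eqF.
have := invariant_set_orthogonal inv (@subIsetl _ _ _) Sx.
rewrite PA dot_mulmx_skew// -/w dotZr => /eqP.
by rewrite oppr_eq0 mulf_eq0 invr_eq0 sqrtr_eq0 leNgt ww_gt0/= gt_eqF.
Qed.

(** The flow of a skew-symmetric matrix acts by isometries. *)
Lemma dot_flow_constant {R : realType} {m : nat} (A : 'M[R]_m)
    (f g : R -> 'cV[R]_m) :
  A^T = - A ->
  (forall t, is_derive t (1 : R) f (A *m f t)) ->
  (forall t, is_derive t (1 : R) g (A *m g t)) ->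
  forall s t, dot (f s) (g s) = dot (f t) (g t).
Proof.
move=> skA Df Dg s t.
apply: (@is_derive_0_is_cst _ (fun t => dot (f t) (g t))) => r.
apply: (is_derive_eq (is_derive_dot (Df r) (Dg r))).
by rewrite (dotC (g r)) dot_mulmx_skew// addNr.
Qed.

(** When [A *m a = 0], the constant curve [a] is a solution, so by
    [dot_flow_constant] every solution keeps its product with [a] as well as
    its norm; the great sphere is then the union of the orbits [exp (t A) x] of its
    points. *)
Lemma kernel_invariant_hyperplane_sphere {R : realType} {n : nat}
    (P : vfield R n.+1) (A : 'M[R]_n.+1) (a : 'cV[R]_n.+1) :
  A^T = - A -> (forall x, vfield_eval P x = A *m x) ->
  A *m a = 0 -> invariant_set P (hyperplane a `&` unit_sphere R n).
Proof.
move=> skA PA Aa0; set S := _ `&` _.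
have Dcst t : is_derive t (1 : R) (cst a) (A *m cst a t).
  by rewrite /cst Aa0; exact: is_derive_cst.
have orbitS x : S x -> range (expmx_orbit A x) `<=` S.
  move=> [ax xx] _ [t _ <-]; split.
    rewrite /hyperplane /= -/(dot _ _).
    have := dot_flow_constant skA Dcst (is_derive_expmx_orbit A x) t 0.
    by rewrite expmx_orbit0 => ->.
  rewrite /unit_sphere /= -dot_sqr.
  rewrite (dot_flow_constant skA (is_derive_expmx_orbit A x)
             (is_derive_expmx_orbit A x) t 0).
  by rewrite expmx_orbit0 dot_sqr.
exists [set T | exists2 x, S x & T = range (expmx_orbit A x)]; split.
  move=> _ [x _ ->]; apply: trajectory_total => t.
  by rewrite PA; exact: is_derive_expmx_orbit.
apply/seteqP; split=> [x Sx|x [_ [y Sy ->]]]; last exact: orbitS.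
exists (range (expmx_orbit A x)); first by exists x.
by exists 0 => //; rewrite expmx_orbit0.
Qed.

Theorem theorem1p6 (R : realType) (n : nat) (hn : (2 <= n)%N)
    (P : vfield R n.+1)
    (hdeg : vfield_degree P = 1%N)
    (hsphere : vfield_on_sphere P)
    (A : 'M[R]_n.+1)
    (hskew : A^T = - A)
    (hP : forall i : 'I_n.+1, P i = \sum_(j < n.+1) A i j *: mvar R j)
    (a : 'cV[R]_n.+1)
    (ha : \sum_(i < n.+1) a i 0 ^+ 2 = 1) :
  invariant_great_sphere P (hyperplane a `&` unit_sphere R n) <->
  col_eigenvector A 0 a.
Proof.
have PA x : vfield_eval P x = A *m x by exact: vfield_eval_linear.
split=> [[_ inv]|[_]].
  split; last by rewrite scale0r; exact: invariant_hyperplane_sphere_kernel inv.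
  by apply: contra_eq_neq ha => ->; rewrite -dot_sqr dot0l eq_sym oner_eq0.
rewrite scale0r => Aa0; split; first by exists a.
exact: kernel_invariant_hyperplane_sphere Aa0.
Qed.
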